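(* Let $f\in\mathcal{S}_L$ with $\arg\min f\neq\varnothing$, and fix $x^\star\in\arg\min f$. Let $x_0,y_0\in\mathbb{R}^d$, let $P_0\in\mathbb{R}^{d\times d}$ be diagonal with $P_0\succ0$, and set $P_{-1}:=P_0$. Generate $(x_k,y_k,P_k)$ by $$\frac{x_{k+1}-x_k}{\alpha_k}=y_k-x_{k+1}-\beta_kP_{k-1}^{-1}\nabla f(x_k),\qquad \frac{y_{k+1}-y_k}{\alpha_k}=-P_k^{-1}\nabla f(x_{k+1}),$$ $$\frac{P_{k+1}-P_k}{\alpha_k}=-P_{k+1}+\gamma_kP_k^{-1}G_{k+1}^2,\qquad G_{k+1}^2=\mathrm{diag}\big((\partial_1 f(x_{k+1}))^2,\dots,(\partial_d f(x_{k+1}))^2\big),$$ the method being terminated at the first index $\ell$ with $\nabla f(x_\ell)=0$, if there is one. Put $\eta_k:=\alpha_k\beta_k$ and $x_k^+:=x_k-\eta_kP_{k-1}^{-1}\nabla f(x_k)$ (so $x_\ell^+=x_\ell$ at a terminal index $\ell$). Assume there exists $R>0$ with $$\sup_{k\ge0}\|y_k-x^\star\|_\infty\le R .$$ For each $k$ with $\nabla f(x_k)\ne0$ let the parameters be chosen such that $$\eta_k=\bar\eta(P_{k-1}^{-1},\nabla f(x_k)),\qquad 0<\alpha_k\le\sqrt{\eta_k/2},\qquad \gamma_k=\alpha_k/R^2 .$$ Assume further that for all $k\ge0$ (for which $\eta_{k+1}$ is defined, i.e. $x_{k+1}$ is generated and $\nabla f(x_{k+1})\neq 0$) $$2\alpha_k^2\le\eta_{k+1}(1+\alpha_k).$$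 Then for all $k\ge0$ (for which $x_{k+1}$ is generated) $$\mathcal{E}_{k+1}\le\mathcal{E}_0\prod_{j=0}^{k}\frac{1}{1+\alpha_j},\qquad\text{where}\quad \mathcal{E}_k:=f(x_k^+)-f(x^\star)+\tfrac12\|y_k-x^\star\|_{P_k}^2 .$$
   Context: $\mathcal{S}_L$ ($L>0$) is the set of differentiable convex functions $f:\mathbb{R}^d\to\mathbb{R}$ whose gradient is $L$-Lipschitz in the Euclidean norm. For a symmetric matrix $A$, $\|x\|_A^2:=\langle Ax,x\rangle$; $A\succ0$ means symmetric positive definite. $\|\cdot\|_\infty$ is the maximum norm. For $P\succ0$ and $g\ne0$, $$\bar\eta(P^{-1},g):=\frac1L\,\frac{\|g\|_{P^{-1}}^2}{\|g\|_{P^{-2}}^2}.$$ The parameters satisfy $\alpha_k,\beta_k,\gamma_k>0$; since $\eta_k=\alpha_k\beta_k$, the choice of $\eta_k$ and $\alpha_k$ determines $\beta_k=\eta_k/\alpha_k$. All matrices $P_k$ are diagonal and positive definite. If $\nabla f(x_\ell)=0$, then $x_\ell$ is a minimizer and the method stops there; if there is no such $\ell$, the sequences are infinite. *)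

(* Defs.v *)
From HB Require Import structures.
From mathcomp Require Import all_boot all_order all_algebra.
From mathcomp Require Import all_classical all_reals all_analysis.

Set Implicit Arguments.
Unset Strict Implicit.
Unset Printing Implicit Defensive.

Import Order.TTheory GRing.Theory Num.Theory.
Import numFieldNormedType.Exports.

Local Open Scope classical_set_scope.
Local Open Scope ring_scope.

Section Definitions.
Context {R : realType} {d : nat}.
Implicit Types (f : 'cV[R]_d -> R) (A : 'M[R]_d).

Definition dotv (u v : 'cV[R]_d) : R := \sum_i u i 0 * v i 0.

(* The library norm `|u| on 'cV[R]_d is the maximum norm. *)
Definition enorm (u : 'cV[R]_d) : R := Num.sqrt (dotv u u).

Definition wnormsq A (u : 'cV[R]_d) : R := dotv (A *m u) u.

Definition posdefmx A : Prop :=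
  A^T = A /\ forall u : 'cV[R]_d, u != 0 -> 0 < dotv (A *m u) u.

(* Partial derivatives; this is the gradient where f is differentiable. *)
Definition grad f (u : 'cV[R]_d) : 'cV[R]_d :=
  \col_i 'D_(delta_mx i 0) f u.

(* The class S_L. *)
Definition smooth_convex (L : R) f : Prop :=
  [/\ convex_function [set: convex_lmodType 'cV[R]_d] f,
      forall u, differentiable f u
    & forall u v, enorm (grad f u - grad f v) <= L * enorm (u - v)].

Definition is_argmin f (u : 'cV[R]_d) : Prop := forall v, f u <= f v.

(* To be used with A = P^-1, so that A *m A = P^-2. *)
Definition etabar (L : R) A (g : 'cV[R]_d) : R :=
  L^-1 * (wnormsq A g / wnormsq (A *m A) g).

(* G^2 = diag ((g_1)^2, ..., (g_d)^2). *)
Definition Gsq (g : 'cV[R]_d) : 'M[R]_d := diag_mx (\row_i (g i 0) ^+ 2).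

(* P_{k-1}, with the convention P_{-1} = P_0 (as 0.-1 = 0 in nat). *)
Definition Pprev (P : nat -> 'M[R]_d) (k : nat) : 'M[R]_d := P k.-1.

(* The k-th iterate exists, i.e. the method has not terminated at an index
   j < k.  The sequences below are total functions on nat, whose values at
   indices that are not reached are unconstrained and irrelevant. *)
Definition reached f (x : nat -> 'cV[R]_d) (k : nat) : Prop :=
  forall j, (j < k)%N -> grad f (x j) != 0.

Definition method f (alpha beta gamma : nat -> R)
    (x y : nat -> 'cV[R]_d) (P : nat -> 'M[R]_d) : Prop :=
  forall k, reached f x k.+1 ->
  [/\ (alpha k)^-1 *: (x k.+1 - x k) =
        y k - x k.+1 - beta k *: (invmx (Pprev P k) *m grad f (x k)),
      (alpha k)^-1 *: (y k.+1 - y k) =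
        - (invmx (P k) *m grad f (x k.+1))
    & (alpha k)^-1 *: (P k.+1 - P k) =
        - P k.+1 + gamma k *: (invmx (P k) *m Gsq (grad f (x k.+1)))].

(* At a terminal index grad f (x k) = 0, hence xplus = x k whatever eta k is. *)
Definition xplus f (eta : nat -> R) (x : nat -> 'cV[R]_d)
    (P : nat -> 'M[R]_d) (k : nat) : 'cV[R]_d :=
  x k - eta k *: (invmx (Pprev P k) *m grad f (x k)).

Definition energy f (xstar : 'cV[R]_d) (eta : nat -> R)
    (x y : nat -> 'cV[R]_d) (P : nat -> 'M[R]_d) (k : nat) : R :=
  f (xplus f eta x P k) - f xstar + 2^-1 * wnormsq (P k) (y k - xstar).

End Definitions.

(* Main.v *)
Require Import Defs.
From HB Require Import structures.
From mathcomp Require Import all_boot all_order all_algebra.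
From mathcomp Require Import all_classical all_reals all_analysis.
From mathcomp Require Import ring lra.
Import Order.TTheory GRing.Theory Num.Theory.
Import numFieldNormedType.Exports.
Local Open Scope ring_scope.

(** One iteration is analysed through a single inequality: with
    [g = grad f x'], [x'] the new point, [xp] the gradient step [x_k^+] taken
    from the old one, [A] and [B] the old and new preconditioners and [z] the
    minimizer,
    [(1 + a) * E_new <= E_old + (2 * a ^+ 2 - e * (1 + a)) / 2 * ||g||^2],
    where the last norm is the one weighted by [A^-1]; the condition relating
    two consecutive parameters makes the last term nonpositive.
    Iterating gives the product of the factors [(1 + alpha j)^-1].

    The inequality is the sum of three estimates.
    - Sufficient decrease ([preconditioned_descent]): the step size [etabar] is
      the one which minimizes the quadratic upper bound of the descent lemma
      along the direction [A^-1 g], so that the gradient step lowers [f] by at least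
      [e / 2 * ||g||^2].
    - Convexity, used between [x'] and [xp] and between [x'] and [z]: since
      [x' - xp = a (y - x')], the two linear terms add up to
      [a * dotv g (y - z)].
    - The distance term ([weighted_distance_step]): expanding the square of
      [y' - z = y - z - a A^-1 g] produces [- a * dotv g (y - z)], which cancels
      the previous term, and [a ^+ 2 / 2 * ||g||^2].  The change of metric from
      [A] to [B] contributes, coordinatewise,
      [a ^+ 2 / r ^+ 2 * (g_i ^+ 2 / A_ii) * (y'_i - z_i) ^+ 2 / 2]; the bound
      [r] on the maximum norm of [y' - z] turns this into a second copy of
      [a ^+ 2 / 2 * ||g||^2]. *)

(** * Euclidean inner product *)

Section DotProduct.
Set Implicit Arguments.
Unset Strict Implicit.
Context {R : realType} {d : nat}.
Implicit Types (u v w : 'cV[R]_d) (c : R).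

Lemma dotvC u v : dotv u v = dotv v u.
Proof. by apply: eq_bigr => i _; rewrite mulrC. Qed.

Lemma dotvDr u v w : dotv u (v + w) = dotv u v + dotv u w.
Proof. by rewrite -big_split; apply: eq_bigr => i _; rewrite mxE mulrDr. Qed.

Lemma dotvZr c u v : dotv u (c *: v) = c * dotv u v.
Proof. by rewrite mulr_sumr; apply: eq_bigr => i _; rewrite mxE mulrCA. Qed.

Lemma dotvBr u v w : dotv u (v - w) = dotv u v - dotv u w.
Proof. by rewrite -scaleN1r dotvDr dotvZr mulN1r. Qed.

Lemma dotvBl u v w : dotv (u - v) w = dotv u w - dotv v w.
Proof. by rewrite dotvC dotvBr !(dotvC w). Qed.

Lemma dotv_ge0 u : 0 <= dotv u u.
Proof. by apply: sumr_ge0 => i _; rewrite -expr2 sqr_ge0. Qed.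

Lemma enorm_ge0 u : 0 <= enorm u.
Proof. exact: sqrtr_ge0. Qed.

Lemma sqr_enorm u : enorm u ^+ 2 = dotv u u.
Proof. exact/sqr_sqrtr/dotv_ge0. Qed.

Lemma enormZ c u : 0 <= c -> enorm (c *: u) = c * enorm u.
Proof.
move=> c0; rewrite /enorm dotvZr dotvC dotvZr mulrA -expr2.
by rewrite sqrtrM ?sqr_ge0// sqrtr_sqr ger0_norm.
Qed.

(** A form of the Cauchy-Schwarz inequality, obtained by expanding
    [dotv (u - c *: v) (u - c *: v) >= 0]. *)
Lemma dotv_le_of_enorm c u v :
  0 < c -> enorm u <= c * enorm v -> dotv u v <= c * dotv v v.
Proof.
move=> c0; rewrite -ler_sqr ?nnegrE ?mulr_ge0 ?enorm_ge0 ?(ltW c0)//.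
rewrite exprMn !sqr_enorm => uv.
have := dotv_ge0 (u - c *: v).
rewrite dotvBr !dotvBl !dotvZr ![dotv (c *: v) _]dotvC !dotvZr.
by move=> uv2; rewrite -(ler_pM2l c0); lra.
Qed.

Lemma cV_delta u : u = \sum_i u i 0 *: delta_mx i 0.
Proof.
rewrite [LHS]matrix_sum_delta; apply: eq_bigr => i _.
by rewrite big_ord1.
Qed.

End DotProduct.

(** * Smooth convex functions *)

Section SmoothConvex.
Set Implicit Arguments.
Unset Strict Implicit.
Context {R : realType} {d : nat}.
Implicit Types (f : 'cV[R]_d -> R) (u h : 'cV[R]_d).

Lemma derive_dotv_grad f u h :
  differentiable f u -> 'D_h f u = dotv (grad f u) h.
Proof.
move=> df; rewrite deriveE// {1}(cV_delta h) linear_sum/=.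
by apply: eq_bigr => i _; rewrite linearZ/= mxE deriveE// mulrC.
Qed.

(** The difference quotients of [f] along the line are those of the directional
    derivative at [u + t *: h]. *)
Lemma is_derive_line f u h (t : R) : (forall v, differentiable f v) ->
  is_derive t 1 (fun s : R => f (u + s *: h) : R)
    (dotv (grad f (u + t *: h)) h).
Proof.
move=> df; rewrite -derive_dotv_grad//.
have E : (fun s : R => s^-1 *: (f (u + (s *: 1 + t) *: h) - f (u + t *: h))) =
         (fun s : R => s^-1 *: (f (s *: h + (u + t *: h)) - f (u + t *: h))).
  apply/funext => s; congr (_ *: (f _ - _)).
  by rewrite scalerDl [s *: (1 : R)]mulr1 addrCA.
apply: DeriveDef.
  have := @diff_derivable _ _ _ f _ h (df (u + t *: h)).
  by rewrite /derivable -E.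
by rewrite /derive -E.
Qed.

Lemma convex_grad_le f u v :
  convex_function [set: convex_lmodType 'cV[R]_d]%classic f ->
  differentiable f u -> f u + dotv (grad f u) (v - u) <= f v.
Proof.
move=> cf df; rewrite -lerBrDl -derive_dotv_grad//.
have /cvg_ex[l fl] := @diff_derivable _ _ _ f _ (v - u) df.
rewrite /derive (cvg_lim _ fl)//.
(* the slopes f (u + t (v - u)) at t in ]0, 1] are at most f v - f u *)
apply: (cvgr_to_le (cvg_dnbhs_at_right fl)).
near=> t.
have t0 : 0 < t by [].
have t1 : t <= 1 by near: t; apply: nbhs_right_le.
have /= := cf (Itv01 (ltW t0) t1) v u; rewrite !in_setT => /(_ isT isT).
rewrite !convRE /= {1}/conv/= /unstable.onem => fle.
rewrite [_ *: _]mulrC ler_pdivrMr//=.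
have -> : t *: (v - u) + u = t *: v + (1 - t) *: u.
  by rewrite scalerBr scalerBl scale1r addrAC -addrA.
by move: fle; lra.
Unshelve. all: by end_near. Qed.

Lemma descent_lemma L f u h : 0 < L -> smooth_convex L f ->
  f (u + h) <= f u + dotv (grad f u) h + L / 2 * dotv h h.
Proof.
move=> L0 [_ df lip].
(* the gap to the quadratic upper bound, nonincreasing on [0, 1] *)
pose g (t : R) : R :=
  f (u + t *: h) - (t * dotv (grad f u) h + t ^+ 2 * (L / 2 * dotv h h)).
pose g' (t : R) : R := dotv (grad f (u + t *: h)) h -
    (dotv (grad f u) h + t * (L * dotv h h)).
have gE (t : R) : is_derive t 1 g (g' t).
  have fD := @is_derive_line f u h t df.
  apply: is_derive_eq.
  rewrite /g' /GRing.scale/=; congr (_ - _); by field.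
have gcont : {within `[0, 1], continuous g}%classic.
  apply: derivable_within_continuous => x _.
  exact: (@ex_derive _ _ _ _ _ _ _ (gE x)).
have [c] := MVT ltr01 (fun t _ => gE t) gcont.
rewrite in_itv/= => /andP[c0 c1]; rewrite subr0 mulr1 => gc.
suff g'c : g' c <= 0.
  by move: g'c; rewrite -gc /g scale1r scale0r addr0; lra.
have : dotv (grad f (u + c *: h) - grad f u) h <= L * c * dotv h h.
  apply: dotv_le_of_enorm; first by rewrite mulr_gt0.
  apply: (le_trans (lip _ _)).
  by rewrite addrAC subrr add0r enormZ ?(ltW c0)// mulrA.
by rewrite dotvBl /g'; lra.
Qed.

End SmoothConvex.

(** * Diagonal preconditioners *)

Section DiagonalMatrices.
Set Implicit Arguments.
Unset Strict Implicit.
Context {R : realType} {d : nat}.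
Implicit Types (A B : 'M[R]_d) (p : 'rV[R]_d) (g u : 'cV[R]_d) (c : R).

Lemma invmx_diag p :
  (forall i, p 0 i != 0) -> invmx (diag_mx p) = diag_mx (map_mx GRing.inv p).
Proof.
move=> p0.
have pV : diag_mx p *m diag_mx (map_mx GRing.inv p) = 1%:M.
  rewrite mulmx_diag -diag_const_mx; congr diag_mx.
  by apply/rowP => i; rewrite !mxE divff.
by rewrite -[RHS](mulKmx (mulmx1_unit pV).1) pV mulmx1.
Qed.

Lemma wnormsq_diag p u :
  wnormsq (diag_mx p) u = \sum_i p 0 i * u i 0 ^+ 2.
Proof. by apply: eq_bigr => i _; rewrite mul_diag_mx !mxE expr2 mulrA. Qed.

Lemma wnormsqZ A c u : wnormsq A (c *: u) = c ^+ 2 * wnormsq A u.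
Proof. by rewrite /wnormsq -scalemxAr dotvZr dotvC dotvZr dotvC mulrA. Qed.

(** Diagonal matrices with positive diagonal, i.e. the diagonal matrices among
    the positive definite ones, given by their diagonal. *)
Definition posdiag A : Prop :=
  exists2 p : 'rV[R]_d, A = diag_mx p & forall i, 0 < p 0 i.

Lemma posdiag_of_posdef A :
  is_diag_mx A -> posdefmx A -> posdiag A.
Proof.
move=> /diag_mxP[p ->] [_ ppos]; exists p => // i.
have := ppos (delta_mx i 0); rewrite -/(wnormsq _ _) wnormsq_diag.
rewrite (bigD1 i)//= big1 => [|j ji]; last first.
  by rewrite mxE (negPf ji)/= expr0n mulr0.
rewrite mxE !eqxx expr1n mulr1 addr0; apply.
apply/eqP => /matrixP/(_ i 0); rewrite !mxE !eqxx => /eqP.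
by rewrite oner_eq0.
Qed.

Lemma posdiag_invmx A : posdiag A -> posdiag (invmx A).
Proof.
move=> [p -> p0]; exists (map_mx GRing.inv p).
  by rewrite invmx_diag// => i; rewrite gt_eqF.
by move=> i; rewrite mxE invr_gt0.
Qed.

Lemma wnormsq_ge0 A u : posdiag A -> 0 <= wnormsq A u.
Proof.
move=> [p -> p0]; rewrite wnormsq_diag; apply: sumr_ge0 => i _.
by rewrite mulr_ge0 ?sqr_ge0// ltW.
Qed.

(** The step size [etabar] makes the quadratic term of the descent lemma equal to
    half of the linear one.  When [g = 0] the quotient is [0 / 0 = 0] and both
    sides vanish. *)
Lemma etabar_wnormsq L A g : 0 < L -> posdiag A ->
  L * etabar L A g * wnormsq (A *m A) g = wnormsq A g.
Proof.
move=> L0 [p -> p0]; rewrite /etabar mulrA mulfV ?gt_eqF// mul1r.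
have [W0|W0] := eqVneq (wnormsq (diag_mx p *m diag_mx p) g) 0; last first.
  by rewrite divfK.
rewrite W0 mulr0; move: W0; rewrite mulmx_diag !wnormsq_diag.
move=> /psumr_eq0P W0; rewrite big1// => i _.
have nng j : true -> 0 <= (\row_k (p 0 k * p 0 k)) 0 j * g j 0 ^+ 2.
  by rewrite mxE mulr_ge0 ?sqr_ge0// mulr_ge0// ltW.
move: (W0 nng i isT) => /eqP; rewrite mxE mulf_eq0 mulf_eq0 gt_eqF//=.
by rewrite sqrf_eq0 => /eqP ->; rewrite expr0n mulr0.
Qed.

Lemma dotv_mulmx_diag A g : posdiag A ->
  dotv (A *m g) (A *m g) = wnormsq (A *m A) g.
Proof.
move=> [p -> p0]; rewrite mulmx_diag wnormsq_diag; apply: eq_bigr => i _.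
by rewrite mul_diag_mx !mxE; ring.
Qed.

Lemma preconditioned_descent f L A u :
  0 < L -> smooth_convex L f -> posdiag A ->
  f (u - etabar L A (grad f u) *: (A *m grad f u)) <=
  f u - etabar L A (grad f u) / 2 * wnormsq A (grad f u).
Proof.
move=> L0 fL Apos; set g := grad f u; set eta := etabar L A g.
apply: (le_trans (descent_lemma _ _ L0 fL)); rewrite -scaleNr !dotvZr.
rewrite [dotv (_ *: _) _]dotvC dotvZr dotv_mulmx_diag//.
rewrite -/g (dotvC g) -/(wnormsq A g) -(etabar_wnormsq g L0 Apos) -/eta.
lra.
Qed.

(** The implicit update of the preconditioner, in closed form. *)
Lemma diag_update p B (a c : R) g :
  0 < a -> (forall i, 0 < p 0 i) ->
  a^-1 *: (B - diag_mx p) = - B + c *: (invmx (diag_mx p) *m Gsq g) ->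
  B = diag_mx (\row_i ((p 0 i + a * c * (g i 0 ^+ 2 / p 0 i)) / (1 + a))).
Proof.
move=> a0 p0; rewrite invmx_diag => [|i]; last by rewrite gt_eqF.
have a1 : 1 + a != 0 by rewrite gt_eqF// addr_gt0.
have a_neq0 : a != 0 by rewrite gt_eqF.
rewrite mulmx_diag => /matrixP BE; apply/matrixP => i j.
have := BE i j; rewrite !mxE; case: eqVneq => [->|_] /=.
  have pj : p 0 j != 0 by rewrite gt_eqF.
  rewrite !mulr1n => /(congr1 (GRing.mul a)); rewrite mulVKf// => E.
  have {}E : (1 + a) * B j j = p 0 j + a * c * (g j 0 ^+ 2 / p 0 j).
    by rewrite mulrDl mul1r -[X in X + _](subrK (p 0 j)) E; ring.
  by rewrite -E mulrAC mulfV// mul1r.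
rewrite !mulr0n mulr0 subr0 addr0 => /(congr1 (GRing.mul a)).
rewrite mulVKf// => E.
apply: (mulfI a1); rewrite mulr0 mulrDl mul1r {1}E; ring.
Qed.

Lemma posdiag_update A B (a c : R) g : 0 < a -> 0 < c ->
  a^-1 *: (B - A) = - B + c *: (invmx A *m Gsq g) -> posdiag A ->
  posdiag B.
Proof.
move=> a0 c0 BE [p A_p p0]; rewrite A_p in BE.
rewrite (diag_update a0 p0 BE); eexists; first by [].
move=> i; rewrite mxE divr_gt0//; last by rewrite addr_gt0.
rewrite ltr_wpDr// mulr_ge0//; first by rewrite mulr_ge0// ltW.
by rewrite divr_ge0 ?sqr_ge0// ltW.
Qed.

(** The factor [2] of the last term collects one [a ^+ 2] from the square of the
    step and one from the change of metric. *)
Lemma weighted_distance_step A B (a r : R) g (y y' z : 'cV[R]_d) :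
  0 < a -> 0 < r -> posdiag A ->
  a^-1 *: (y' - y) = - (invmx A *m g) ->
  a^-1 *: (B - A) = - B + (a / r ^+ 2) *: (invmx A *m Gsq g) ->
  `|y' - z| <= r ->
  (1 + a) * wnormsq B (y' - z) <=
  wnormsq A (y - z) - 2 * a * dotv g (y - z) + 2 * a ^+ 2 * wnormsq (invmx A) g.
Proof.
move=> a0 r0 [p -> p0] yE BE yr.
rewrite (diag_update a0 p0 BE) invmx_diag => [|i]; last by rewrite gt_eqF.
rewrite !wnormsq_diag !mulr_sumr -sumrB -big_split/=.
apply: ler_sum => i _; rewrite !mxE; set pi := p 0 i; set gi := g i 0.
have pi0 : pi != 0 by rewrite gt_eqF ?p0.
have a1 : 1 + a != 0 by rewrite gt_eqF// addr_gt0.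
have {yE} yi : y' i 0 = y i 0 - a * (gi / pi).
  move: yE; rewrite invmx_diag => [/colP/(_ i)|j]; last by rewrite gt_eqF.
  rewrite mul_diag_mx !mxE -/gi -/pi => /(congr1 (GRing.mul a)).
  by rewrite mulVKf ?gt_eqF// => E; rewrite -[LHS](subrK (y i 0)) E; ring.
have ri : (y' i 0 - z i 0) ^+ 2 <= r ^+ 2.
  rewrite -[leLHS]real_normK ?num_real// ler_sqr ?nnegrE ?normr_ge0 ?(ltW r0)//.
  apply: le_trans yr; rewrite [leRHS]/Num.norm/= mx_normrE.
  by apply/bigmax_geP; right; exists (i, 0); rewrite //= !mxE.
rewrite (_ : (1 + a) * _ = pi * (y' i 0 - z i 0) ^+ 2 +
  a ^+ 2 * (gi ^+ 2 / pi) * ((y' i 0 - z i 0) ^+ 2 / r ^+ 2)); last first.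
  by field; rewrite a1 pi0 gt_eqF.
have : a ^+ 2 * (gi ^+ 2 / pi) * ((y' i 0 - z i 0) ^+ 2 / r ^+ 2) <=
       a ^+ 2 * (gi ^+ 2 / pi).
  rewrite ler_piMr//; last by rewrite ler_pdivrMr ?exprn_gt0// mul1r.
  by rewrite mulr_ge0 ?sqr_ge0// divr_ge0 ?sqr_ge0// ltW ?p0.
have -> : pi * (y' i 0 - z i 0) ^+ 2 = pi * (y i 0 - z i 0) ^+ 2 -
  2 * a * (gi * (y i 0 - z i 0)) + a ^+ 2 * (gi ^+ 2 / pi).
  by rewrite yi; field.
by rewrite (mulrC pi^-1); move: (gi ^+ 2 / pi) => q; lra.
Qed.

(** * Contraction of the energy *)

(** At a stationary point [x'] the step size [e] is arbitrary, since it multiplies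
    the zero vector. *)
Lemma energy_step f L A B (a r e : R) (z xp x' y y' : 'cV[R]_d) :
  0 < L -> smooth_convex L f -> posdiag A -> 0 < a -> 0 < r ->
  a^-1 *: (x' - xp) = y - x' ->
  a^-1 *: (y' - y) = - (invmx A *m grad f x') ->
  a^-1 *: (B - A) = - B + (a / r ^+ 2) *: (invmx A *m Gsq (grad f x')) ->
  `|y' - z| <= r ->
  (grad f x' != 0 ->
    e = etabar L (invmx A) (grad f x') /\ 2 * a ^+ 2 <= e * (1 + a)) ->
  (1 + a) * (f (x' - e *: (invmx A *m grad f x')) - f z +
             2^-1 * wnormsq B (y' - z)) <=
  f xp - f z + 2^-1 * wnormsq A (y - z).
Proof.
move=> L0 fL Apos a0 r0 xE yE BE yr eE; set g := grad f x'.
have [cf df _] := fL.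
have AVpos := posdiag_invmx Apos.
have quad := weighted_distance_step a0 r0 Apos yE BE yr.
rewrite -/g in quad.
have gz : dotv g x' - dotv g z >= f x' - f z.
  by have := convex_grad_le z cf (df x'); rewrite -/g dotvBr; lra.
have gxp : dotv g x' - dotv g xp >= f x' - f xp.
  by have := convex_grad_le xp cf (df x'); rewrite -/g dotvBr; lra.
have xxp : dotv g x' - dotv g xp = a * (dotv g y - dotv g x').
  by rewrite -!dotvBr -xE dotvZr mulVKf ?gt_eqF.
rewrite dotvBr in quad.
have W0 := wnormsq_ge0 g AVpos.
have desc :
    f (x' - e *: (invmx A *m g)) <= f x' - e / 2 * wnormsq (invmx A) g /\
    2 * a ^+ 2 * wnormsq (invmx A) g <= e * (1 + a) * wnormsq (invmx A) g.
  have [g0|/eE[-> ae]] := eqVneq g 0.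
    have wn0 : wnormsq (invmx A) 0 = 0.
      by rewrite -(scale0r (0 : 'cV[R]_d)) wnormsqZ expr0n mul0r.
    by rewrite g0 wn0 mulmx0 scaler0 !mulr0 !subr0.
  by split; [exact: preconditioned_descent|exact: ler_wpM2r].
have [d1 d2] := desc.
have {}d1 : (1 + a) * f (x' - e *: (invmx A *m g)) <=
    (1 + a) * (f x' - e / 2 * wnormsq (invmx A) g).
  by rewrite ler_pM2l ?addr_gt0.
have agz : a * (f x' - f z) <= a * (dotv g x' - dotv g z) by rewrite ler_pM2l.
move: quad gxp d1 d2 agz xxp.
move: (f (x' - _)) (wnormsq (invmx A) g) (wnormsq B _) (wnormsq A _).
by move=> fx W WB WA; do 4!move: (dotv g _) => ?; lra.
Qed.

End DiagonalMatrices.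

Theorem theorem3p1 (R : realType) (d : nat) (L : R) (f : 'cV[R]_d -> R)
    (xstar : 'cV[R]_d) (x y : nat -> 'cV[R]_d) (P : nat -> 'M[R]_d)
    (alpha beta gamma : nat -> R) (rad : R)
    (eta := fun k => alpha k * beta k) :
  0 < L ->
  smooth_convex L f ->
  is_argmin f xstar ->
  is_diag_mx (P 0%N) ->
  posdefmx (P 0%N) ->
  method f alpha beta gamma x y P ->
  0 < rad ->
  (forall k, reached f x k -> `|y k - xstar| <= rad) ->
  (forall k, reached f x k.+1 ->
    [/\ 0 < alpha k, 0 < beta k & 0 < gamma k]) ->
  (forall k, reached f x k.+1 ->
    [/\ eta k = etabar L (invmx (Pprev P k)) (grad f (x k)),
        0 < alpha k <= Num.sqrt (eta k / 2)
      & gamma k = alpha k / rad ^+ 2]) ->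
  (forall k, reached f x k.+2 ->
    2 * alpha k ^+ 2 <= eta k.+1 * (1 + alpha k)) ->
  forall k, reached f x k.+1 ->
    energy f xstar eta x y P k.+1 <=
    energy f xstar eta x y P 0 * \prod_(0 <= j < k.+1) (1 + alpha j)^-1.
Proof.
move=> L0 fL _ P0diag P0pos mth rad0 ybnd pos params step k.
have reachedW n : reached f x n.+1 -> reached f x n.
  by move=> rn j jn; apply: rn; rewrite ltnS ltnW.
have Ppos n : reached f x n -> posdiag (P n).
  elim: n => [_|n IHn rn]; first exact: posdiag_of_posdef.
  have [_ _ PE] := mth n rn; have [a0 _ c0] := pos n rn.
  exact: posdiag_update a0 c0 PE (IHn (reachedW _ rn)).
have contraction n : reached f x n.+1 ->
    (1 + alpha n) * energy f xstar eta x y P n.+1 <= energy f xstar eta x y P n.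
  move=> rn; have [xE yE PE] := mth n rn; have [a0 _ _] := pos n rn.
  have [_ _ cE] := params n rn; rewrite cE in PE.
  have An := Ppos n (reachedW _ rn).
  apply: (energy_step L0 fL An a0 rad0 _ yE PE (ybnd _ rn)).
    rewrite /xplus opprB addrA addrAC scalerDr xE scalerA /eta mulKf ?gt_eqF//.
    exact: subrK.
  move=> gn0; have rn2 : reached f x n.+2.
    by move=> j; rewrite ltnS leq_eqVlt => /predU1P[->//|]; exact: rn.
  have [eE _ _] := params n.+1 rn2; split; [exact: eE|exact: step].
move: k.+1 => {}k; elim: k => [_|k IHk rk]; first by rewrite big_geq ?mulr1.
have [a0 _ _] := pos k rk.
rewrite big_nat_recr//= mulrA ler_pdivlMr ?addr_gt0// mulrC.
exact: le_trans (contraction k rk) (IHk (reachedW _ rk)).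
Qed.
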